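(* Let $R$ be a $*$-ring. Then $R$ is strongly $\pi$-$*$-regular if and only if $R$ is $*$-abelian, $J(R)$ is nil, and the $*$-ring $R/J(R)$ is strongly $\pi$-$*$-regular.
   Context: All rings are associative with identity $1\neq 0$ (not necessarily commutative). An involution on a ring $R$ is a map $*:R\to R$ with $(x+y)^*=x^*+y^*$, $(xy)^*=y^*x^*$ and $(x^* )^*=x$ for all $x,y\in R$; a $*$-ring is a ring equipped with an involution. A projection of a $*$-ring is an element $p$ with $p^2=p=p^*$. A $*$-ring is $*$-abelian if all of its projections are central. $J(R)$ denotes the Jacobson radical of $R$; it is nil if each of its elements is nilpotent. If $R$ is a $*$-ring, then $R/J(R)$ is regarded as a $*$-ring with the induced involution $(x+J(R))^*=x^*+J(R)$. $U(R)$ denotes the group of units of $R$. A $*$-ring $R$ is strongly $\pi$-$*$-regular if for every $a\in R$ there exist an integer $n\geq 1$, a projection $p\in R$ and a unit $u\in U(R)$ such that $a^n=pu$ and $a,p,u$ commute with each other. *)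

(* Defs.v *)
From HB Require Import structures.
From mathcomp Require Import all_boot all_algebra.
From mathcomp Require Import boolp classical_sets.

Set Implicit Arguments.
Unset Strict Implicit.
Unset Printing Implicit Defensive.

Import GRing.Theory.
Local Open Scope classical_set_scope.
Local Open Scope ring_scope.

HB.mixin Record hasInvolution R of GRing.NzRing R := {
  star : R -> R;
  starD : forall x y : R, star (x + y) = star x + star y;
  starM : forall x y : R, star (x * y) = star y * star x;
  starK : forall x : R, star (star x) = x
}.

#[short(type="starRingType")]
HB.structure Definition StarRing := {R of GRing.NzRing R & hasInvolution R}.

Section StarTheory.
Variable R : starRingType.

Lemma star0 : star 0 = 0 :> R.
Proof. by apply: (addrI (star 0)); rewrite -starD !addr0. Qed.

Lemma starN (x : R) : star (- x) = - star x.
Proof. by apply: (addrI (star x)); rewrite -starD !subrr star0. Qed.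

Lemma starB (x y : R) : star (x - y) = star x - star y.
Proof. by rewrite starD starN. Qed.

Lemma star1 : star 1 = 1 :> R.
Proof. by rewrite -[LHS]mulr1 -[X in _ * X]starK -starM mulr1 starK. Qed.

End StarTheory.

Section StarRingNotions.
Variable R : starRingType.

Definition projection (p : R) : Prop := p * p = p /\ star p = p.

Definition star_abelian : Prop :=
  forall p : R, projection p -> forall x : R, GRing.comm p x.

(* [GRing.unit] needs a [unitRingType]; the rings here are only [nzRingType]s. *)
Definition invertible (u : R) : Prop := exists v : R, v * u = 1 /\ u * v = 1.

Definition strongly_pi_star_regular : Prop :=
  forall a : R, exists (n : nat) (p u : R),
    [/\ (1 <= n)%N, projection p, invertible u, a ^+ n = p * u
      & [/\ GRing.comm a p, GRing.comm a u & GRing.comm p u]].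

End StarRingNotions.

Arguments star_abelian : clear implicits.
Arguments strongly_pi_star_regular : clear implicits.

Section JacobsonRadical.
Variable R : nzRingType.

Definition left_ideal (I : set R) : Prop :=
  [/\ I 0, forall x y, I x -> I y -> I (x + y) & forall a x, I x -> I (a * x)].

Definition maximal_left_ideal (M : set R) : Prop :=
  [/\ left_ideal M, M != setT
    & forall I : set R, left_ideal I -> M `<=` I -> I != setT -> I = M].

Definition jacobson : set R :=
  [set x | forall M : set R, maximal_left_ideal M -> M x].

Definition is_nil (A : set R) : Prop :=
  forall x, A x -> exists n : nat, x ^+ n = 0.

Lemma left_ideal_proper (I : set R) : left_ideal I -> (I != setT) <-> ~ I 1.
Proof.
move=> [_ _ IM]; split=> [/eqP IT I1|I1]; last by apply/eqP => IT; apply: I1; rewrite IT.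
by apply: IT; apply/seteqP; split=> // x _; rewrite -[x]mulr1; apply: IM.
Qed.

Lemma left_idealN (I : set R) x : left_ideal I -> I x -> I (- x).
Proof. by move=> [_ _ IM] Ix; rewrite -mulN1r; apply: IM. Qed.

Lemma maximal_left_ideal_exists (I : set R) : left_ideal I -> ~ I 1 ->
  exists2 M, maximal_left_ideal M & I `<=` M.
Proof.
move=> idI I1.
pose P (X : set R) := X = set0 \/ [/\ left_ideal X, ~ X 1 & I `<=` X].
have [F FP totF|M [PM maxM]] := @Zorn_bigcup _ P.
  have [[X0 FX0 nX0]|F0] := pselect (exists2 X, F X & X !=set0); last first.
    left; apply/seteqP; split=> // x [X FX Xx].
    by apply: F0; exists X => //; exists x.
  have FPn X x : F X -> X x -> [/\ left_ideal X, ~ X 1 & I `<=` X].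
    by move=> FX Xx; have [X0'|//] := FP X FX; rewrite X0' in Xx.
  have [x0 X0x0] := nX0; have [[X00 _ _] _ IX0] := FPn _ _ FX0 X0x0.
  right; split.
  - split; first by exists X0.
    + move=> x y [X FX Xx] [Y FY Yy].
      have [[_ XD _] _ _] := FPn _ _ FX Xx; have [[_ YD _] _ _] := FPn _ _ FY Yy.
      have [XY|YX] := totF _ _ FX FY.
        by exists Y => //; apply: YD => //; apply: XY.
      by exists X => //; apply: XD => //; apply: YX.
    + move=> a x [X FX Xx]; have [[_ _ XM] _ _] := FPn _ _ FX Xx.
      by exists X => //; apply: XM.
  - by move=> [X FX X1]; have [_] := FPn _ _ FX X1.
  - by move=> x Ix; exists X0 => //; apply: IX0.
have I0 : I 0 by case: idI.
have {PM} [M0|[idM M1 IM]] := PM.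
  exfalso; apply: (maxM I); last by right; split.
  by rewrite M0; split=> [x []|/(_ 0 I0)].
exists M => //; split=> //; first exact/left_ideal_proper.
move=> K idK MK /(left_ideal_proper idK) K1.
apply/seteqP; split=> //; apply: contrapT => KM.
by apply: (maxM K); [split | right; split=> //; apply: subset_trans MK].
Qed.

Lemma jacobsonP x : jacobson x <-> forall a, exists b, b * (1 - a * x) = 1.
Proof.
split=> [Jx a|Lx M [idM /(left_ideal_proper idM) M1 maxM]].
  apply: contrapT => nb.
  pose I : set R := [set y | exists c, y = c * (1 - a * x)].
  have [|[c c1]|M maxM IM] := @maximal_left_ideal_exists I.
  - split; first by exists 0; rewrite mul0r.
    + by move=> _ _ [c ->] [d ->]; exists (c + d); rewrite mulrDl.
    + by move=> e _ [c ->]; exists (e * c); rewrite mulrA.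
  - by apply: nb; exists c.
  have Mx := Jx M maxM; have [idM /(left_ideal_proper idM) M1 _] := maxM.
  have [_ MD MM] := idM; apply: M1.
  rewrite -[1](subrK (a * x)); apply: MD; last exact: MM.
  by apply: IM; exists 1; rewrite mul1r.
apply: contrapT => nMx; have [M0 MD MM] := idM.
pose K : set R := [set y | exists m a, M m /\ y = m + a * x].
have idK : left_ideal K.
  split; first by exists 0, 0; rewrite mul0r addr0.
  - move=> _ _ [m [a [Mm ->]]] [m' [a' [Mm' ->]]].
    by exists (m + m'), (a + a'); split; [apply: MD | rewrite mulrDl addrACA].
  - move=> c _ [m [a [Mm ->]]].
    by exists (c * m), (c * a); split; [apply: MM | rewrite mulrDr mulrA].
have MK : M `<=` K by move=> m Mm; exists m, 0; rewrite mul0r addr0.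
have Kx : K x by exists 0, 1; rewrite mul1r add0r.
have [/(left_ideal_proper idK) K1|] := pselect (K != setT).
  by apply: nMx; rewrite -(maxM K idK MK) //; apply/left_ideal_proper.
move=> /(left_ideal_proper idK)/contrapT [m [a [Mm e]]].
have [b b1] := Lx a; apply: M1; rewrite -b1; apply: MM.
by rewrite e addrK.
Qed.

Lemma jacobson_left_ideal : left_ideal jacobson.
Proof.
split=> [M [[]]|x y Jx Jy M maxM|a x Jx M maxM] //.
  by have [[_ MD _] _ _] := maxM; apply: MD; [apply: Jx | apply: Jy].
by have [[_ _ MM] _ _] := maxM; apply: MM; apply: Jx.
Qed.

Lemma jacobsonMl a x : jacobson x -> jacobson (a * x).
Proof. by case: jacobson_left_ideal => _ _; apply. Qed.

Lemma jacobsonMr x r : jacobson x -> jacobson (x * r).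
Proof.
move=> /jacobsonP Lx; apply/jacobsonP => a.
have [c c1] := Lx (r * a); exists (1 + a * x * c * r).
have e : c * r - c * r * (a * x * r) = r.
  by rewrite -[in RHS](mul1r r) -c1 mulrBr mulr1 mulrBl !mulrA.
rewrite mulrDl mul1r mulrBr mulr1 [a * (x * r)]mulrA.
by rewrite -(mulrA (a * x) c r) -(mulrA (a * x) (c * r)) -mulrBr e subrK.
Qed.

Lemma jacobson_rinv x : jacobson x -> exists b, (1 - x) * b = 1.
Proof.
move=> /jacobsonP Lx; have [b] := Lx 1; rewrite mul1r => b1.
have bE : b = 1 - (- b) * x by rewrite mulNr opprK -{1}b1 mulrBr mulr1 subrK.
have [c] := Lx (- b); rewrite -bE => c1.
have cE : c * b * (1 - x) = c by rewrite -mulrA b1 mulr1.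
by exists b; rewrite -[1 - x]mul1r -{1}c1 cE.
Qed.

Lemma jacobson1 : ~ jacobson 1.
Proof.
move=> /jacobsonP/(_ 1)[b]; rewrite mulr1 subrr mulr0 => /esym/eqP.
by rewrite oner_eq0.
Qed.

Definition jacobson_pred : {pred R} := fun x => x \in jacobson.

Lemma jacobson_predE x : (x \in jacobson_pred) = `[< jacobson x >].
Proof. by []. Qed.

Lemma jacobson_pred_zmod_closed : zmod_closed jacobson_pred.
Proof.
have [J0 JD JM] := jacobson_left_ideal; split=> [|x y]; first exact/asboolP.
move=> /asboolP Jx /asboolP Jy; apply/asboolP; apply: JD => //.
exact: left_idealN jacobson_left_ideal _.
Qed.

HB.instance Definition _ :=
  GRing.isZmodClosed.Build R jacobson_pred jacobson_pred_zmod_closed.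

End JacobsonRadical.

Arguments jacobson : clear implicits.

(* [ring_quotient] only puts a ring structure on quotients of commutative      *)
(* rings, so the multiplication on the additive quotient is added here.        *)
Definition jacobson_quot (R : nzRingType) : Type :=
  {ideal_quot (@jacobson_pred R)}.

HB.instance Definition _ (R : nzRingType) :=
  ZmodQuotient.on (jacobson_quot R).

Section QuotientRing.
Variable R : nzRingType.
Local Notation Q := (jacobson_quot R).
Local Notation pi := (\pi_Q%qT : R -> Q).

Lemma jacobson_quotE (x y : R) : pi x = pi y <-> jacobson R (x - y).
Proof.
split=> [/eqP|Jxy].
  by rewrite -Quotient.idealrBE => /asboolP.
by apply/eqP; rewrite -Quotient.idealrBE; apply/asboolP.
Qed.

Lemma jacobson_piD (x y : R) : pi (x + y) = pi x + pi y.
Proof. exact: Quotient.pi_add. Qed.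

Lemma jacobson_repr (x : R) : jacobson R (x - repr (pi x)).
Proof. by apply/jacobson_quotE; rewrite reprK. Qed.

Definition quot_one : Q := lift_cst Q 1.
Definition quot_mul : Q -> Q -> Q := lift_op2 Q *%R.

Lemma quot_piM (x y : R) : pi (x * y) = quot_mul (pi x) (pi y).
Proof.
unlock quot_mul; apply/jacobson_quotE; have [_ JD _] := jacobson_left_ideal R.
rewrite -[_ * _](subrK (x * repr (pi y))) -mulrBr -addrA -mulrBl.
by apply: JD; [apply: jacobsonMl | apply: jacobsonMr]; apply: jacobson_repr.
Qed.

Lemma quot_pi1 : pi 1 = quot_one.
Proof. by unlock quot_one. Qed.

Lemma quot_mulA : associative quot_mul.
Proof.
by move=> x y z; rewrite -[x]reprK -[y]reprK -[z]reprK -!quot_piM mulrA.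
Qed.

Lemma quot_mul1 : left_id quot_one quot_mul.
Proof. by move=> x; rewrite -[x]reprK -quot_pi1 -quot_piM mul1r. Qed.

Lemma quot_mul1r : right_id quot_one quot_mul.
Proof. by move=> x; rewrite -[x]reprK -quot_pi1 -quot_piM mulr1. Qed.

Lemma quot_mulDl : left_distributive quot_mul +%R.
Proof.
move=> x y z; rewrite -[x]reprK -[y]reprK -[z]reprK.
by rewrite -!jacobson_piD -!quot_piM mulrDl jacobson_piD.
Qed.

Lemma quot_mulDr : right_distributive quot_mul +%R.
Proof.
move=> x y z; rewrite -[x]reprK -[y]reprK -[z]reprK.
by rewrite -!jacobson_piD -!quot_piM mulrDr jacobson_piD.
Qed.

Lemma quot_one_neq0 : quot_one != 0.
Proof.
have pi0 : pi 0 = 0 by apply: (addrI (pi 0)); rewrite -jacobson_piD !addr0.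
by apply/eqP; rewrite -pi0 -quot_pi1 => /jacobson_quotE; rewrite subr0; apply: jacobson1.
Qed.

HB.instance Definition _ := GRing.Zmodule_isNzRing.Build Q
  quot_mulA quot_mul1 quot_mul1r quot_mulDl quot_mulDr quot_one_neq0.

HB.instance Definition _ := @isNzRingQuotient.Build R
  (Quotient.equiv (@jacobson_pred R)) 0 -%R +%R 1 *%R Q quot_pi1 quot_piM.

End QuotientRing.

Section QuotientStar.
Variable R : starRingType.
Local Notation Q := (jacobson_quot R).
Local Notation pi := (\pi_Q%qT : R -> Q).

Lemma jacobson_star (x : R) : jacobson R x -> jacobson R (star x).
Proof.
move=> Jx; apply/jacobsonP => a.
have [b b1] := jacobson_rinv (jacobsonMr (star a) Jx); exists (star b).
by move: (congr1 star b1); rewrite starM starB !star1 starM starK.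
Qed.

Definition quot_star : Q -> Q := lift_op1 Q star.

Lemma quot_star_pi (x : R) : quot_star (pi x) = pi (star x).
Proof.
unlock quot_star; apply/esym/jacobson_quotE; rewrite -starB.
apply: jacobson_star; exact: jacobson_repr.
Qed.

Lemma quot_starD (x y : Q) : quot_star (x + y) = quot_star x + quot_star y.
Proof.
rewrite -[x]reprK -[y]reprK -jacobson_piD !quot_star_pi.
by rewrite starD jacobson_piD.
Qed.

Lemma quot_starM (x y : Q) : quot_star (x * y) = quot_star y * quot_star x.
Proof.
rewrite -[x]reprK -[y]reprK -[_ * _]quot_piM !quot_star_pi.
by rewrite starM [LHS]quot_piM.
Qed.

Lemma quot_starK (x : Q) : quot_star (quot_star x) = x.
Proof. by rewrite -[x]reprK !quot_star_pi starK. Qed.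

HB.instance Definition _ :=
  hasInvolution.Build Q quot_starD quot_starM quot_starK.

End QuotientStar.

(* Main.v *)
Require Import Defs.
From mathcomp Require Import all_boot all_algebra.

(** In a strongly pi-star-regular ring every idempotent is a projection, and
    [e + e x (1 - e)] being self-adjoint for every [x] forces [e] to be central;
    an element of the radical is nilpotent because the projection in its
    decomposition lies in the radical.  Conversely, the projection in a
    decomposition of a power [a ^+ n] modulo the radical lifts to a projection
    [e], which is central.  Then [a ^+ n * e + (1 - e)] is a unit because it is
    one modulo the radical, [a ^+ n * (1 - e)] is in the radical, hence
    nilpotent, and a power of [a ^+ n] is [e] times a unit. *)

Set Implicit Arguments.
Unset Strict Implicit.
Unset Printing Implicit Defensive.

Import GRing.Theory.
Local Open Scope ring_scope.

(** * Units: products, powers, one-sided inverses *)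

Section Invertible.
Variable R : starRingType.
Implicit Types (u v x y : R).

Lemma invertible1 : invertible (1 : R).
Proof. by exists 1; rewrite mulr1. Qed.

Lemma invertibleM u v : invertible u -> invertible v -> invertible (u * v).
Proof.
move=> [u' [u'u uu']] [v' [v'v vv']]; exists (v' * u'); split.
  by rewrite mulrA -(mulrA v') u'u mulr1.
by rewrite mulrA -(mulrA u) vv' mulr1.
Qed.

Lemma invertibleX u n : invertible u -> invertible (u ^+ n).
Proof.
by move=> uU; elim: n => [|n IH]; [exact: invertible1 | rewrite exprS; exact: invertibleM].
Qed.

Lemma invertible_linv_rinv u x y : x * u = 1 -> u * y = 1 -> invertible u.
Proof.
move=> xu uy; exists x; split=> //.
by rewrite -[X in u * X]mulr1 -uy (mulrA x) xu mul1r.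
Qed.

End Invertible.

(** * Idempotents and the radical, without the involution *)

Section RingIdempotents.
Variable R : nzRingType.
Implicit Types (e u v y : R).

Lemma idempotent_mul_compl e : e * e = e -> e * (1 - e) = 0.
Proof. by move=> ee; rewrite mulrBr mulr1 ee subrr. Qed.

Lemma idempotent_compl_mul e : e * e = e -> (1 - e) * e = 0.
Proof. by move=> ee; rewrite mulrBl mul1r ee subrr. Qed.

Lemma idempotent_compl e : e * e = e -> (1 - e) * (1 - e) = 1 - e.
Proof. by move=> ee; rewrite mulrBr mulr1 idempotent_compl_mul // subr0. Qed.

(** The mixed terms vanish because [e] and [1 - e] are orthogonal and [e] commutes with [u]; the
    element [e * u + (1 - e)] is [u] on the corner of [e] and 1 on the complementary one. *)
Lemma corner_mul1 e u v : e * e = e -> GRing.comm e u -> u * v = 1 ->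
  (e * u + (1 - e)) * (e * v + (1 - e)) = 1.
Proof.
move=> ee eu uv; rewrite mulrDl [X in X + _]mulrDr [X in _ + X]mulrDr.
rewrite idempotent_compl // (mulrA (1 - e)) idempotent_compl_mul // mul0r add0r.
rewrite {2}[e * u]eu -(mulrA u e (1 - e)) idempotent_mul_compl // mulr0 addr0.
by rewrite -mulrA (mulrA u) -(eu : e * u = u * e) -mulrA uv mulr1 ee subrKC.
Qed.

Lemma idempotentX e n : e * e = e -> e ^+ n.+1 = e.
Proof. by move=> ee; elim: n => // n IH; rewrite exprS IH. Qed.

(** [1 - e] has a left inverse and annihilates [e]. *)
Lemma jacobson_idempotent e : jacobson R e -> e * e = e -> e = 0.
Proof.
move=> /jacobsonP/(_ 1)[b]; rewrite mul1r => b1 ee.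
by rewrite -[LHS]mul1r -b1 -mulrA idempotent_compl_mul // mulr0.
Qed.

(* With [s = y] and [t = 1 - y] one has [s ^+ k * t ^+ k = 0]; the element
   [1 - (1 - s ^+ k) ^+ k] is a multiple of [s ^+ k] and its complement one of
   [t ^+ k]. *)
Lemma idempotent_of_nilpotent_defect y k :
  (y * (1 - y)) ^+ k = 0 ->
  let e := 1 - (1 - y ^+ k) ^+ k in e * e = e.
Proof.
move=> yk e; pose f : R := (1 - y ^+ k) ^+ k.
have c1 (z : R) : GRing.comm z (1 - z).
  by apply: commrB; [exact: commr1 | exact: commr_refl].
have [g eg] : exists g, e = g * y ^+ k.
  exists (\sum_(i < k) (1 - y ^+ k) ^+ i).
  have -> : e = (1 - (1 - y ^+ k)) * \sum_(i < k) (1 - y ^+ k) ^+ i.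
    by rewrite -[1 - (1 - _)]opprB mulNr -subrX1 opprB.
  rewrite subKr; apply: commr_sum => i _; exact/commrX/c1.
have [h fh] : exists h, f = (1 - y) ^+ k * h.
  exists ((\sum_(i < k) y ^+ i) ^+ k).
  rewrite /f -opprB subrX1 -mulNr opprB exprMn_comm //.
  by apply: commr_sum => i _; apply: commrX; apply/commr_sym.
have ef : e * f = 0.
  by rewrite eg fh mulrA -(mulrA g) -exprMn_comm // yk mulr0 mul0r.
by rewrite -[X in _ * X]/(1 - f) mulrBr ef mulr1 subr0.
Qed.

End RingIdempotents.

(** * Idempotents in the presence of the involution *)

Section Idempotents.
Variable R : starRingType.
Implicit Types (e : R).

Lemma projections_idempotent_central :
  (forall e, e * e = e -> star e = e) ->
  forall e, e * e = e -> forall x, GRing.comm e x.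
Proof.
move=> idemP e ee.
have half x : e * x * (1 - e) = 0.
  pose y := e * x * (1 - e).
  have ey : e * y = y by rewrite /y !mulrA ee.
  have ye : y * e = 0 by rewrite /y -mulrA idempotent_compl_mul // mulr0.
  have yy : y * y = 0 by rewrite -{2}ey mulrA ye mul0r.
  have /idemP : (e + y) * (e + y) = e + y.
    by rewrite mulrDl !mulrDr ee ey ye yy addr0 addr0.
  rewrite starD (idemP _ ee) => /addrI sy.
  (* Here [y = e * y = star e * star y = star (y * e)], which is 0. *)
  by rewrite -/y -ey -sy -(idemP _ ee) -starM ye star0.
move=> x; rewrite /GRing.comm.
have ex : e * x = e * x * e.
  by apply/eqP; rewrite -subr_eq0 -{1}[e * x]mulr1 -mulrBr half.
have xe : x * e = e * x * e.
  (* Applying [star] reduces this to [half] at [star x]. *)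
  apply: (can_inj (@starK R)); rewrite !starM (idemP _ ee) mulrA.
  by apply/eqP; rewrite -subr_eq0 -{1}[e * star x]mulr1 -mulrBr half.
by rewrite ex xe.
Qed.

(** Since [e ^+ n = e], the decomposition reads [e = p * u], whence [p * e = e] and, inverting [u],
    [e * p = p]; as [e] and [p] commute, [e = p]. *)
Lemma strongly_pi_star_regular_idempotent :
  strongly_pi_star_regular R -> forall e, e * e = e -> star e = e.
Proof.
move=> regR e ee; have [n [p [u [n0 [pp sp] [v [vu uv]] epu [ep _ pu]]]]] := regR e.
have en : e ^+ n = e.
  by case: n n0 {epu} => // n _; exact: idempotentX.
rewrite en in epu.
have pe : p * e = e by rewrite epu mulrA pp.
have ev : e * v = p by rewrite epu -mulrA uv mulr1.
have pE : e * p = p by rewrite -ev mulrA ee.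
by rewrite -pe -ep pE sp.
Qed.

End Idempotents.

(** * Passage between the ring and its quotient by the radical *)

Section QuotientProjection.
Variable R : starRingType.
Local Notation Q := (jacobson_quot R).
Local Notation pi := (\pi_Q%qT : R -> Q).

Lemma jacobson_piM (x y : R) : pi (x * y) = pi x * pi y.
Proof. exact: quot_piM. Qed.

Lemma jacobson_pi1 : pi 1 = 1.
Proof. exact: quot_pi1. Qed.

Lemma jacobson_piB (x y : R) : pi (x - y) = pi x - pi y.
Proof. by apply: (addIr (pi y)); rewrite -jacobson_piD !subrK. Qed.

Lemma jacobson_piX (x : R) n : pi (x ^+ n) = pi x ^+ n.
Proof.
by elim: n => [|n IH]; [exact: jacobson_pi1 | rewrite !exprS jacobson_piM IH].
Qed.

Lemma jacobson_pi_star (x : R) : star (pi x) = pi (star x).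
Proof. exact: quot_star_pi. Qed.

Lemma jacobson_pi0P (x : R) : pi x = 0 <-> jacobson R x.
Proof.
have pi0 : pi 0 = 0 by rewrite -(subrr 0) jacobson_piB subrr.
by rewrite -pi0 jacobson_quotE subr0.
Qed.

Lemma invertible_pi (x : R) : invertible x -> invertible (pi x).
Proof.
by move=> [y [yx xy]]; exists (pi y); rewrite -!jacobson_piM yx xy jacobson_pi1.
Qed.

(** For a lift [y] of the inverse, [y * x] and [x * y] are 1 modulo the radical, so they have a left
    and a right inverse respectively. *)
Lemma invertible_pi_lift (x : R) : invertible (pi x) -> invertible x.
Proof.
move=> [y']; rewrite -[y']reprK; set y := repr y' => -[].
rewrite -!jacobson_piM -jacobson_pi1 => /esym/jacobson_quotE yx /esym/jacobson_quotE xy.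
have /jacobsonP/(_ 1)[b] := yx; rewrite mul1r subKr mulrA => bx.
have [c] := jacobson_rinv xy; rewrite subKr -mulrA => xc.
exact: invertible_linv_rinv bx xc.
Qed.

Lemma projection_lift (q : Q) : is_nil (jacobson R) -> projection q ->
  exists2 e : R, projection e & pi e = q.
Proof.
move=> nilJ [qq sq]; set x := repr q; have xq : pi x = q := reprK q.
(* A self-adjoint lift of [q], since [star q * q = q]. *)
pose y := star x * x.
have sy : star y = y by rewrite starM starK.
have yq : pi y = q by rewrite jacobson_piM -jacobson_pi_star xq sq.
(* The exponent is kept positive so that powers of [q] and [1 - q] collapse. *)
have [k yk] : exists k, (y * (1 - y)) ^+ k.+1 = 0.
  have [|k yk] := nilJ (y * (1 - y)); last by exists k; rewrite exprS yk mulr0.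
  apply/jacobson_pi0P; rewrite jacobson_piM jacobson_piB jacobson_pi1 yq.
  exact: idempotent_mul_compl.
have starX (z : R) n : star z = z -> star (z ^+ n) = z ^+ n.
  move=> sz; elim: n => [|n IH]; first by rewrite expr0 star1.
  by rewrite exprS starM IH sz -exprSr exprS.
exists (1 - (1 - y ^+ k.+1) ^+ k.+1).
  split; first exact: idempotent_of_nilpotent_defect.
  by rewrite starB star1 starX // starB star1 starX.
(* The polynomial defining the lift fixes the idempotent [q]. *)
rewrite jacobson_piB jacobson_piX jacobson_piB jacobson_piX jacobson_pi1 yq.
by rewrite !idempotentX ?subKr //; exact: idempotent_compl.
Qed.

Lemma strongly_pi_star_regular_quot :
  strongly_pi_star_regular R -> strongly_pi_star_regular Q.
Proof.
move=> regR a; rewrite -[a]reprK.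
have [n [p [u [n0 [pp sp] uU apu [ap au pu]]]]] := regR (repr a).
exists n, (pi p), (pi u); split=> //.
- by split; rewrite ?jacobson_pi_star ?sp // -jacobson_piM pp.
- exact: invertible_pi.
- by rewrite -jacobson_piX apu jacobson_piM.
- by split; rewrite /GRing.comm -!jacobson_piM ?ap ?au ?pu.
Qed.

End QuotientProjection.

(** * The two directions of the equivalence *)

Lemma strongly_pi_star_regular_lift (R : starRingType) :
  star_abelian R -> is_nil (jacobson R) ->
  strongly_pi_star_regular (jacobson_quot R) -> strongly_pi_star_regular R.
Proof.
move=> abR nilJ regQ a.
have [n [q [w [n0 projq [v [vw wv]] aqw [_ _ qw]]]]] := regQ (\pi a)%qT.
have [e proje piE] := projection_lift nilJ projq.
have ce := abR e proje; have [ee _] := proje; have [qq _] := projq.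
have cf x : GRing.comm (1 - e) x.
  by apply: commr_sym; apply: commrB; [exact: commr1 | apply: commr_sym].
(* As the inverse of [w] also commutes with [q], [corner_mul1] applies to the product in both
   orders. *)
have qv : GRing.comm q v.
  by rewrite /GRing.comm -[q * v]mul1r -vw mulrA -(mulrA v) -qw mulrA -mulrA wv mulr1.
pose b := a ^+ n * e + (1 - e).
have bU : invertible b.
  apply: invertible_pi_lift.
  have -> : (\pi b)%qT = q * w + (1 - q) :> jacobson_quot R.
    by rewrite jacobson_piD jacobson_piM jacobson_piX jacobson_piB jacobson_pi1 piE
      aqw qw -mulrA qq.
  by exists (q * v + (1 - q)); split; exact: corner_mul1.
have [m am] : exists m, (a ^+ n * (1 - e)) ^+ m.+1 = 0.
  have [|m am] := nilJ (a ^+ n * (1 - e)); last by exists m; rewrite exprS am mulr0.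
  apply/jacobson_pi0P.
  by rewrite jacobson_piM jacobson_piX jacobson_piB jacobson_pi1 piE aqw qw -mulrA
    idempotent_mul_compl ?mulr0.
have {}am : a ^+ (n * m.+1) * (1 - e) = 0.
  rewrite -am exprMn_comm; last exact/commr_sym.
  by rewrite (idempotentX m (idempotent_compl ee)) exprM.
have eb : e * b = e * a ^+ n.
  by rewrite mulrDr idempotent_mul_compl // addr0 -(ce (a ^+ n)) mulrA ee.
(* The left side is [(e * a ^+ n) ^+ m.+1], that is [e * a ^+ (n * m.+1)], and [am] says that the
   complementary part of this power of [a] is 0. *)
have ebm : e * b ^+ m.+1 = a ^+ (n * m.+1).
  rewrite -{1}(idempotentX m ee) -exprMn_comm // eb exprMn_comm // idempotentX // -exprM.
  by apply/esym/eqP; rewrite ce -subr_eq0 -{1}[a ^+ _]mulr1 -mulrBr am.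
exists (n * m.+1)%N, e, (b ^+ m.+1); split=> //.
- by rewrite muln_gt0 n0.
- exact: invertibleX.
- split; [exact/commr_sym | | exact: ce].
  apply/commrX/commrD; last exact/commr_sym.
  by apply: commrM; [apply/commrX/commr_refl | exact/commr_sym].
Qed.

Theorem proposition2p8 (R : starRingType) :
  strongly_pi_star_regular R <->
  [/\ star_abelian R, is_nil (jacobson R)
    & strongly_pi_star_regular (jacobson_quot R)].
Proof.
split=> [regR|[abR nilJ regQ]]; last exact: strongly_pi_star_regular_lift.
split; last exact: strongly_pi_star_regular_quot.
  move=> p [pp _]; apply: projections_idempotent_central => //.
  exact: strongly_pi_star_regular_idempotent.
move=> a Ja; have [n [p [u [n0 [pp _] [v [_ uv]] apu _]]]] := regR a.
have pE : a ^+ n * v = p by rewrite apu -mulrA uv mulr1.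
exists n; rewrite apu (jacobson_idempotent _ pp) ?mul0r // -pE.
(* A positive exponent leaves a factor [a], which puts [p = a ^+ n * v] in the radical. *)
case: n n0 {apu pE} => // n _; rewrite exprSr.
by apply: jacobsonMr; apply: jacobsonMl.
Qed.
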